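(* There is a function $f:(0,\infty)\to\mathbb{N}$ with the following property. Let $G$ be a finite group and let $\epsilon>0$ be a real number such that for any distinct primes $p,q\in\pi(G)$ there is a Sylow $p$-subgroup $P$ and a Sylow $q$-subgroup $Q$ of $G$ such that $\Pr(P,Q)\ge\epsilon$. Then $|G:F_2(G)|\le f(\epsilon)$.
   Context: For subsets $X,Y$ of a finite group $G$, $\Pr(X,Y)=|\{(x,y)\in X\times Y: xy=yx\}|/(|X||Y|)$ is the probability that random elements $x\in X$, $y\in Y$ commute. $\pi(G)$ is the set of prime divisors of $|G|$. $F(G)$ is the Fitting subgroup, and $F_2(G)$ is the second term of the upper Fitting series, i.e. $F_2(G)/F(G)=F(G/F(G))$. *)

(* Defs.v *)
From Stdlib Require Import Reals.
From mathcomp Require Import all_boot all_fingroup all_solvable.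
Set Implicit Arguments. Unset Strict Implicit. Unset Printing Implicit Defensive.

Definition commProb (gT : finGroupType) (X Y : {set gT}) : R :=
  Rdiv (INR #|[set xy in setX X Y | (xy.1 * xy.2 == xy.2 * xy.1)%g]|) (INR (#|X| * #|Y|)).

Definition Fitting2 (gT : finGroupType) (G : {set gT}) : {set gT} :=
  (coset 'F(G) @*^-1 'F(G / 'F(G)))%g.

(* Main.v *)
Require Import Defs.
From Stdlib Require Import Reals Lra ZArith.
From mathcomp Require Import all_boot all_fingroup all_solvable.
From mathcomp Require Import zify.
Set Implicit Arguments. Unset Strict Implicit. Unset Printing Implicit Defensive.

(** Fix an integer [a] of order [2 / eps].  If [Pr(P, Q) >= eps], the elements
    of [P] centralising a subgroup of index at most [a] in [Q] form a symmetric
    set of density at least [1 / a] in [P]; boundedly many products of them fill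
    a subgroup [P1] of index at most [a], so every [x] in [P1] centralises a
    subgroup of bounded index in [Q].

    If [p > a], an index at most [a] in [P] is [1], so [C_Q(P)] has index at most
    [a] in [Q], for every [q].  Hence the number of Sylow [p]-subgroups is at
    most [a ^ (a + 1)], and if [p] exceeds this bound, [P] is normal in [G].
    Thus [G / F(G)] involves only boundedly many primes, and it suffices to
    bound [|P : O_p|] in that quotient for each of them.

    There [P] has a subgroup [P1] of bounded index all of whose elements have
    class sizes with bounded [p']-part.  Then each [x] in [P1] lies in a positive
    proportion of the conjugates of [P], so a positive proportion of conjugates
    [P^g] meet [P] in bounded index; the corresponding [g] generate a subgroup
    [H] of bounded index, all of whose elements have this property with a worse
    bound.  Schlichting's theorem on uniformly commensurable conjugates, in a
    quantitative form, now bounds [|P : O_p(H)|], and so [|P : O_p|]. *)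

Local Open Scope group_scope.
Delimit Scope R_scope with coqR.

(** * Counting lemmas *)

(** A prime q > a dividing n would make the q-part of n exceed a, so only the indices 0, ..., a
    contribute to the product of the parts. *)
Lemma leq_of_partn a n :
  0 < n -> (forall q, prime q -> n`_q <= a)%N -> (n <= a ^ a.+1)%N.
Proof.
move=> n_gt0 le_a; have a_gt0 : 0 < a by apply: leq_trans (le_a 2 isT); rewrite part_gt0.
rewrite -[n in (n <= _)%N](partnT n_gt0) /partn.
have le_term q : (q ^ logn q n <= if q <= a then a else 1)%N.
  case q_pr: (prime q); last by rewrite lognE q_pr expn0; case: ifP.
  have := le_a q q_pr; rewrite p_part; case: (leqP q a) => // lt_aq le_qa.
  have [->|lgt0] := posnP (logn q n); first by rewrite expn0.
  have: (q <= q ^ logn q n)%N by rewrite -{1}(expn1 q) leq_exp2l ?prime_gt1 // lgt0.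
  lia.
apply: (@leq_trans (\prod_(0 <= q < n.+1) (if q <= a then a else 1))).
  by rewrite (eq_bigl xpredT) //; apply: leq_prod => q _; apply: le_term.
rewrite -big_mkcond /= big_const_seq iter_muln_1.
rewrite leq_pexp2l // -size_filter -(size_iota 0 a.+1).
apply: uniq_leq_size; first by rewrite filter_uniq ?iota_uniq.
by move=> q; rewrite mem_filter !mem_iota /=; lia.
Qed.

(** Averaging: the elements left out contribute at most half of the sum that the hypothesis
    guarantees, so the popular ones, worth at most [b] each, supply the rest. *)
Lemma leq_card_popular (T : finType) (A : {set T}) (phi : T -> nat) (b N : nat) :
  0 < b -> (forall x, x \in A -> phi x <= b)%N ->
  (#|A| * b <= N * \sum_(x in A) phi x)%N ->
  (#|A| <= 2 * N * #|[set x in A | b <= 2 * N * phi x]|)%N.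
Proof.
move=> b_gt0 le_b; set X := [set x in A | _] => le_sum.
have: (2 * N * \sum_(x in A) phi x <= 2 * N * (#|X| * b) + #|A| * b)%N.
  have -> : (2 * N * (#|X| * b) = \sum_(x in A) (if x \in X then 2 * N * b else 0))%N.
    rewrite -big_mkcondr /= -sum_nat_const big_distrr /=.
    by apply: eq_bigl => x; rewrite !inE andbA andbb.
  rewrite -sum_nat_const -big_split big_distrr /=.
  apply: leq_sum => x Ax; rewrite inE Ax /=; case: ifP => [_|/negbT].
    by have := leq_mul (leqnn (2 * N)) (le_b x Ax); lia.
  by rewrite -ltnNge; lia.
move=> le2; rewrite -(leq_pmul2r b_gt0); lia.
Qed.

(** * Generation in boundedly many factors *)

(** Right translation by an element of [U] maps the finite set [Y] into itself, hence stabilises it,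
    and the stabiliser of [Y] is a group. *)
Lemma gen_sub_of_mul_closed (gT : finGroupType) (U Y : {set gT}) :
  1 \in Y -> Y * U \subset Y -> <<U>> \subset Y.
Proof.
move=> Y1 sYUY; have sUN: <<U>> \subset 'N(Y | 'R).
  rewrite gen_subG; apply/subsetP=> u Uu; rewrite !inE /=.
  by apply/subsetP=> y Yy; rewrite inE (subsetP sYUY) ?mem_mulg.
apply/subsetP=> u /(subsetP sUN) /astabsP Nu.
by rewrite -[u]mul1g -[1 * u]/('R%act 1 u) Nu.
Qed.

Lemma expg_set_subset (gT : finGroupType) (X : {set gT}) m n :
  1 \in X -> (m <= n)%N -> X ^+ m \subset X ^+ n.
Proof.
move=> X1 le_mn; rewrite -(subnKC le_mn) expgD.
have X1': 1 \in X ^+ (n - m).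
  by elim: (n - m) => [|k IH]; rewrite ?expg0 ?inE // expgS -[1]mulg1 mem_mulg.
by apply/subsetP=> x Xx; rewrite -[x]mulg1 mem_mulg.
Qed.

(* As long as the powers of X grow, X ^+ (3 i + 4) contains a translate of X
   disjoint from X ^+ (3 i + 1). *)
Lemma gen_bounded_power (gT : finGroupType) (G : {group gT}) (X : {set gT}) a :
  X \subset G -> 1 \in X -> (forall x, x \in X -> x^-1 \in X) ->
  (#|G| <= a * #|X|)%N -> <<X>> \subset X ^+ (3 * a).+1.
Proof.
move=> sXG X1 XV leG.
have [/existsP[n /eqP defX] | /existsPn grow] :=
  boolP [exists n : 'I_(3 * a).+1, X ^+ n.+1 == X ^+ n].
  have sX: <<X>> \subset X ^+ n.
    apply: gen_sub_of_mul_closed; last by rewrite -expgSr defX.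
    by rewrite (subsetP (@expg_set_subset _ X 0 n X1 isT)) ?expg0 ?inE.
  by apply: subset_trans sX _; apply: expg_set_subset => //; case: n {defX} => n /=; lia.
have big i : (i <= a)%N -> (i.+1 * #|X| <= #|X ^+ (3 * i).+1|)%N.
  elim: i => [|i IH] lt_ia; first by rewrite mul1n muln0 expg1.
  have lt3 : ((3 * i).+2 < (3 * a).+1)%N by lia.
  have := grow (Ordinal lt3); rewrite /= eqEsubset (expg_set_subset X1 (leqnSn _)) andbT.
  case/subsetPn=> y Xy nXy.
  have dis: [disjoint X ^+ (3 * i).+1 & X :* y].
    apply/pred0P=> z /=; apply/negP=> /andP[Xz /rcosetP[x Xx Dz]]; case/negP: nXy.
    have -> : y = x^-1 * z by rewrite Dz mulKg.
    by rewrite expgS mem_mulg ?XV.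
  have sub: X ^+ (3 * i).+1 :|: X :* y \subset X ^+ (3 * i.+1).+1.
    rewrite subUset (expg_set_subset X1) /=; last by lia.
    rewrite (_ : (3 * i.+1).+1 = (3 * i).+4)%N; last by lia.
    by rewrite [X ^+ _.+4]expgS mulgS ?sub1set.
  apply: leq_trans (subset_leq_card sub).
  rewrite cardsU disjoint_setI0 // cards0 subn0 card_rcoset mulSn addnC.
  by rewrite leq_add2r IH // ltnW.
have /subset_leq_card: X ^+ (3 * a).+1 \subset G.
  by elim: (3 * a).+1 => [|k IH]; rewrite ?expg0 ?sub1G // expgS mul_subG.
have := big a (leqnn a); have: (0 < #|X|)%N by apply/card_gt0P; exists 1.
by nia.
Qed.

(** * Index inequalities, where [#|A : D|] is the index of [A :&: D] in [A] *)

Section Index.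
Variable gT : finGroupType.
Implicit Types A B D G H : {group gT}.

Lemma leq_index_subl A B D : A \subset B -> (#|A : D| <= #|B : D|)%N.
Proof.
move=> sAB; apply: subset_leq_card; rewrite /rcosets.
exact: imsetS.
Qed.

Lemma leq_index_subr A B D : B \subset D -> (#|A : D| <= #|A : B|)%N.
Proof. by move=> sBD; rewrite dvdn_leq ?indexgS. Qed.

Lemma index_setI A B D : (#|A : B :&: D| = #|A : B| * #|A :&: B : D|)%N.
Proof.
rewrite -[LHS](indexgI A (B :&: D)) -[#|A : B|](indexgI A B).
rewrite -[#|A :&: B : D|](indexgI (A :&: B) D) setIA.
by rewrite Lagrange_index ?subsetIl.
Qed.

Lemma leq_index_trans A B D : (#|A : D| <= #|A : B| * #|B : D|)%N.
Proof.
rewrite (leq_trans (leq_index_subr A (subsetIr B D))) // index_setI.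
by rewrite leq_mul2l leq_index_subl ?orbT ?subsetIr.
Qed.

Lemma leq_index_setI A B D : (#|A : B :&: D| <= #|A : B| * #|A : D|)%N.
Proof. by rewrite index_setI leq_mul2l leq_index_subl ?orbT ?subsetIl. Qed.

Definition seq_cap (I : Type) (r : seq I) (F : I -> {group gT}) : {group gT} :=
  foldr (fun i D => F i :&: D)%G [set: gT]%G r.

Lemma mem_seq_cap (I : Type) (r : seq I) (F : I -> {group gT}) x :
  (x \in seq_cap r F) = all (fun i => x \in F i) r.
Proof. by elim: r => [|i r IH] /=; rewrite inE // IH. Qed.

Lemma seq_cap_sub (I : eqType) (r : seq I) (F : I -> {group gT}) i :
  i \in r -> seq_cap r F \subset F i.
Proof. by move=> ri; apply/subsetP=> x; rewrite mem_seq_cap => /allP->. Qed.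

Lemma leq_index_seq_cap (I : eqType) (r : seq I) (F : I -> {group gT}) G a :
  (forall i, i \in r -> #|G : F i| <= a)%N ->
  (#|G : seq_cap r F| <= a ^ size r)%N.
Proof.
elim: r => [|i r IH] le_a /=; first by rewrite leqNgt indexg_gt1 subsetT.
apply: leq_trans (leq_index_setI _ _ _) _; rewrite expnS leq_mul ?le_a ?mem_head //.
by apply: IH => j rj; rewrite le_a // inE rj orbT.
Qed.

(** The conjugate [H :^ x] depends only on the coset [H :* x], so the core is an intersection of at
    most [a] conjugates, each of index at most [a]. *)
Lemma leq_index_gcore G H a :
  H \subset G -> (#|G : H| <= a)%N -> (#|G : gcore H G| <= a ^ a)%N.
Proof.
move=> sHG le_a; have a_gt0: 0 < a by apply: leq_trans le_a; rewrite indexg_gt0.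
pose r := [seq repr C | C <- enum (rcosets H G)].
have sub: seq_cap r (fun x => H :^ x)%G \subset gcore H G.
  apply/bigcapsP=> x Gx; apply: subset_trans (seq_cap_sub _ (_ : repr (H :* x) \in r)) _.
    by apply: map_f; rewrite mem_enum; apply/rcosetsP; exists x.
  by have /rcosetP[h Hh ->] := mem_repr_rcoset H x; rewrite /= conjsgM conjGid.
apply: leq_trans (leq_index_subr G sub) _.
apply: leq_trans (@leq_index_seq_cap _ r (fun x => H :^ x)%G G a _) _.
  move=> y /mapP[C]; rewrite mem_enum => /rcosetsP[x Gx ->] -> {y}.
  have Gy: repr (H :* x) \in G.
    by rewrite (subsetP (mul_subG sHG (_ : [set x] \subset G))) ?sub1set ?mem_repr_rcoset.
  by rewrite /= -{1}(conjGid Gy) indexJg.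
by rewrite leq_pexp2l // size_map -cardE.
Qed.

End Index.

Lemma card_mulG_index (gT : finGroupType) (A B : {group gT}) :
  #|A * B|%g = (#|A : B| * #|B|)%N.
Proof.
apply/eqP; rewrite -(eqn_pmul2r (cardG_gt0 (A :&: B))) -mul_cardG.
by rewrite -(LagrangeI A B) [eqbRHS]mulnC mulnA.
Qed.

(** * Uniformly commensurable conjugates *)

Section ConjugateProducts.
Variable gT : finGroupType.
Implicit Types H P N : {group gT}.

Definition conj_prod N (s : seq gT) : {set gT} := foldr (fun g X => N :^ g * X) 1 s.

Lemma conj_prod_rcons N s g : conj_prod N (rcons s g) = conj_prod N s * N :^ g.
Proof. by elim: s => [|h s IH] /=; rewrite ?mulg1 ?mul1g // IH mulgA. Qed.

Lemma conj_prod1 N s : 1 \in conj_prod N s.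
Proof. by elim: s => [|h s IH] /=; rewrite ?inE // -[1]mulg1 mem_mulg ?group1. Qed.

(* Prolonging a product that is not yet closed under multiplication adds a
   full right coset of N, so its size grows linearly. *)
Lemma conj_prod_grow N H r :
  exists2 s : seq gT, {subset 1 :: s <= H} /\ (size s <= r)%N &
    (r.+1 * #|N| <= #|conj_prod N (1%g :: s)|)%N \/
    <<class_support N H>> \subset conj_prod N (1%g :: s).
Proof.
elim: r => [|r [s [sH szs] [big|closed]]].
- exists nil; first by split=> // x; rewrite inE => /eqP->; rewrite group1.
  by left; rewrite /= conjsg1 mulg1 mul1n.
- have [/exists_inP[g Hg nsub] | /exists_inPn sub] :=
    boolP [exists g in H, ~~ (conj_prod N (1%g :: s) * N :^ g \subset conj_prod N (1%g :: s))].
    exists (rcons s g).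
      split; last by rewrite size_rcons.
      by move=> x; rewrite -rcons_cons mem_rcons inE => /predU1P[-> // | /sH].
    left; rewrite -rcons_cons conj_prod_rcons.
    case/subsetPn: nsub => y Xgy nXy; set X := conj_prod N (1 :: s) in big Xgy nXy *.
    have NX: N * X = X by rewrite /X /= conjsg1 mulgA mulGid.
    have dis: [disjoint X & N :* y].
      apply/pred0P=> z /=; apply/negP=> /andP[Xz /rcosetP[x Nx Dz]]; case/negP: nXy.
      have -> : y = x^-1 * z by rewrite Dz mulKg.
      by rewrite -NX mem_mulg ?groupV.
    have sub: X :|: N :* y \subset X * N :^ g.
      rewrite subUset mulg_subl ?group1 //=.
      by rewrite -NX -mulgA mulgS ?sub1set.
    apply: leq_trans (subset_leq_card sub).
    by rewrite cardsU disjoint_setI0 // cards0 subn0 card_rcoset mulSn addnC leq_add2r.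
  exists s; first by split=> //; apply: leq_trans szs _.
  right; apply: gen_sub_of_mul_closed; first exact: conj_prod1.
  apply/subsetP=> _ /mulsgP[x y Xx + ->]; rewrite class_supportEr => /bigcupP[g Hg Ny].
  by have /negPn/subsetP-> := sub g Hg; rewrite ?mem_mulg.
by exists s; [split=> //; apply: leq_trans szs _ | right].
Qed.

(** Each N^g contains A, and the index bound forces N^g P^h = A P^h by cardinality. Hence left
    multiplication by N^g fixes A P^h. *)
Lemma conj_prod_sub N P s h (A := seq_cap s (fun g => N :^ g)%G) :
  (forall g, g \in s -> #|N :^ g : P :^ h| <= #|A : P :^ h|)%N ->
  conj_prod N s \subset A * P :^ h.
Proof.
move=> le_idx; have sA g : g \in s -> A \subset N :^ g.
  by move/(seq_cap_sub (fun g => N :^ g)%G).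
have mulA g : g \in s -> N :^ g * P :^ h = A * P :^ h.
  move=> sg; apply/eqP; rewrite eq_sym eqEcard mulSg ?sA //.
  by rewrite !(card_mulG_index _ (P :^ h)) leq_mul2r le_idx ?orbT.
suff sub t : {subset t <= s} -> conj_prod N t * P :^ h \subset A * P :^ h.
  by apply: subset_trans (sub s _) => //; rewrite mulg_subl ?group1.
elim: t => [|g t IH] ts /=; first by rewrite mulSg ?sub1G.
have sg: g \in s by rewrite ts ?mem_head.
rewrite -mulgA -(mulA g sg); apply: subset_trans (mulgS _ (IH _)) _.
  by move=> x tx; rewrite ts // inE tx orbT.
by rewrite -(mulA g sg) mulgA mulGid.
Qed.

End ConjugateProducts.

(* By induction on n: if intersecting N with the boundedly many conjugates in
   the product [conj_prod_grow] lowers the maximal index to n - 1, recurse.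
   Otherwise the index n is still attained on the intersection A, at some P^h,
   so the whole product lies in A P^h and is too small to keep growing: it is
   the normal closure of N. *)
Lemma index_pcore_of_commensurable n c :
  {C : nat | forall (gT : finGroupType) (H P N : {group gT}) (p : nat),
     p.-group P -> P \subset H -> N \subset P -> (#|P : N| <= c)%N ->
     (forall h, h \in H -> #|N : P :^ h| <= n)%N ->
     (#|P : 'O_p(H)| <= C)%N}.
Proof.
elim: n c => [|n IHn] c.
  exists 0%N => gT H P N p _ _ _ _ /(_ 1 (group1 H)).
  by rewrite leqNgt indexg_gt0.
(* A product of size (r + 1)|N| would exceed (n + 1)|P|, which bounds |A P^h|. The factors of [d]
   bound |P : N|, |N : P^g| and |P^g : N^g|, so [d] bounds |P : N^g|. *)
pose r := (n.+1 * c)%N; pose d := (c * n.+1 * c)%N.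
have [C IH] := IHn (d ^ r.+1)%N.
exists (C + c * r ^ r)%N => gT H P N p pP sPH sNP le_c le_n.
have [s [sH szs] alt] := conj_prod_grow N H r.
pose A := seq_cap (1 :: s) (fun g => N :^ g)%G.
have sAN: A \subset N.
  by have := seq_cap_sub (fun g => N :^ g)%G (mem_head 1 s); rewrite /= conjsg1.
have c_gt0: 0 < c by apply: leq_trans le_c; rewrite indexg_gt0.
have leA: (#|P : A| <= d ^ r.+1)%N.
  apply: leq_trans (leq_index_seq_cap (a := d) _) _ => [g sg|].
    have Hg := sH g sg.
    apply: leq_trans (leq_index_trans P (P :^ g)%G (N :^ g)%G) _.
    rewrite /= indexJg leq_mul //.
    apply: leq_trans (leq_index_trans P N (P :^ g)%G) _.
    by rewrite leq_mul // le_n.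
  by rewrite leq_pexp2l /d ?muln_gt0 ?c_gt0.
have [/forall_inP le_nA | ] := boolP [forall h in H, #|A : P :^ h| <= n].
  apply: leq_trans (leq_addr _ _).
  by apply: (IH _ _ _ A) => //; apply: subset_trans sNP.
rewrite negb_forall_in => /exists_inP[h Hh]; rewrite -ltnNge => lt_nA.
have sub: conj_prod N (1 :: s) \subset A * P :^ h.
  apply: conj_prod_sub => g sg; apply: leq_trans lt_nA.
  have Hg := sH g sg.
  rewrite -[h](mulgKV g) conjsgM indexJg le_n // groupM ?groupV //.
have cardAP: (#|A * P :^ h|%g <= n.+1 * #|P|)%N.
  rewrite (card_mulG_index _ (P :^ h)) cardJg leq_mul2r.
  by rewrite (leq_trans (leq_index_subl _ sAN)) ?le_n ?orbT.
have cardP: (#|P| <= c * #|N|)%N by rewrite -(Lagrange sNP) mulnC leq_mul2r le_c orbT.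
have := leq_trans (subset_leq_card sub) cardAP => cardX.
have N0 := cardG_gt0 N.
case: alt => [big | sMX].
  by move: (leq_trans big cardX) cardP; rewrite /r; nia.
pose M := <<class_support N H>>%G.
have sNM: N \subset M by rewrite sub_gen // sub_class_support.
have nMH: H \subset 'N(M) by rewrite norms_gen ?class_support_norm.
have idxM: (#|M : N| <= r)%N.
  rewrite -(leq_pmul2l N0) Lagrange //.
  apply: leq_trans (subset_leq_card sMX) _.
  by apply: leq_trans cardX _; rewrite /r; nia.
(* The core is a normal p-subgroup of M, so it lies in O_p(M), which is characteristic in the normal
   subgroup M of H. *)
have sLO: gcore N M \subset 'O_p(H).
  have sMH: M \subset H by rewrite gen_subG class_support_subG // (subset_trans sNP).
  have nsMH: M <| H by rewrite /normal sMH nMH.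
  apply: subset_trans (pcore_max (_ : p.-group (gcore N M)) (gcore_normal sNM)) _.
    exact: pgroupS (subset_trans (gcore_sub _ _) sNP) pP.
  apply: pcore_max; first exact: pcore_pgroup.
  exact: gFnormal_trans.
apply: leq_trans (leq_index_subr P sLO) _.
apply: leq_trans (leq_index_trans P N _) _.
apply: leq_trans (leq_addl _ _); rewrite leq_mul //.
apply: leq_trans (leq_index_subl _ sNM) _.
exact: leq_index_gcore.
Qed.

(** * Class sizes and the index of the p-core *)

(** The order of P is the p-part of |C| times that of |G : C|, and the p-group P :&: C has order at
    most the p-part of |C|. *)
Lemma leq_partn_index_Sylow (gT : finGroupType) (G P C : {group gT}) p :
  p.-Sylow(G) P -> C \subset G -> (#|G : C|`_p <= #|P : C|)%N.
Proof.
move=> sylP sCG; have := card_Hall sylP; rewrite -(Lagrange sCG) partnM // -(LagrangeI P C).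
have le_p: (#|P :&: C| <= #|C|`_p)%N.
  rewrite dvdn_leq // -(part_pnat_id (_ : p.-nat #|P :&: C|)).
    by rewrite partn_dvd // cardSg ?subsetIr.
  exact: pgroupS (subsetIl _ _) (pHall_pgroup sylP).
move=> E; rewrite -(leq_pmul2l (cardG_gt0 (P :&: C))) E leq_mul2r le_p orbT //.
Qed.

Lemma index_pcore_of_class_sizes c M :
  {C : nat | forall (gT : finGroupType) (G P P1 : {group gT}) (p : nat),
     p.-Sylow(G) P -> P1 \subset P -> (#|P : P1| <= c)%N ->
     (forall x, x \in P1 -> #|G : 'C_G[x]|`_p^' <= M)%N ->
     (#|P : 'O_p(G)| <= C)%N}.
Proof.
(* Averaging gives a set [S] of density at least 1/a whose elements g satisfy |P : P^g| <= a.
   Elements of [<<S>>] are products of 3a + 1 of these, and the indices multiply. *)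
pose a := (2 * (c * M))%N.
have [C0 IH] := index_pcore_of_commensurable (a ^ (3 * a).+1) 1.
exists (C0 * a ^ a)%N => gT G P P1 p sylP sP1P le_c le_M.
have sPG := pHall_sub sylP.
have c_gt0: 0 < c by apply: leq_trans le_c; rewrite indexg_gt0.
have M_gt0: 0 < M by apply: leq_trans (le_M 1 (group1 _)); rewrite part_gt0.
have a_gt0: 0 < a by rewrite /a !muln_gt0 c_gt0.
(* All of P C_G(x) has this property, and its size is at least |G| / M because |P : C_P(x)| is at
   least the p-part of the class size. *)
have leG x : x \in P1 -> (#|G| <= M * #|[set g in G | x \in P :^ g]|)%N.
  move=> P1x; have sub: P * 'C_G[x] \subset [set g in G | x \in P :^ g].
    apply/subsetP=> _ /mulsgP[u v Pu /setIP[Gv /cent1P cvx] ->].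
    rewrite inE groupM ?(subsetP sPG u) //= conjsgM conjGid //.
    by rewrite mem_conjg conjgE invgK mulgA cvx mulgK (subsetP sP1P).
  apply: leq_trans (leq_mul (leqnn M) (subset_leq_card sub)).
  rewrite card_mulG_index mulnA -(Lagrange (subsetIl G 'C[x])) mulnC leq_mul2r.
  rewrite -(partnC p (indexg_gt0 G 'C_G[x])) mulnC leq_mul ?orbT ?le_M //.
  by rewrite leq_partn_index_Sylow ?subsetIl.
(* Double counting of the pairs (x, g) with x in P1 and in P^g; passing from P1 to P costs the
   factor [c]. *)
have le_sum: (#|G| * #|P| <= c * M * \sum_(g in G) #|P :&: P :^ g|)%N.
  have le_sum1: (#|G| * #|P1| <= M * \sum_(g in G) #|P :&: P :^ g|)%N.
    rewrite mulnC -sum_nat_const; apply: leq_trans (leq_sum _ leG) _.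
    rewrite -big_distrr leq_mul2l /=; apply/orP; right.
    under eq_bigr => x _ do rewrite -sum1dep_card big_mkcondr.
    rewrite exchange_big /=; apply: leq_sum => g _.
    rewrite -big_mkcondr sum1_card; apply: subset_leq_card.
    by apply/subsetP=> x /=; rewrite !inE => /andP[/(subsetP sP1P)-> ->].
  rewrite -(Lagrange sP1P) mulnA -mulnA [leqLHS]mulnC mulnC -mulnA mulnC.
  by have := leq_mul le_sum1 le_c; lia.
have le_phi g : g \in G -> (#|P :&: P :^ g| <= #|P|)%N by rewrite subset_leq_card ?subsetIl.
have := leq_card_popular (cardG_gt0 P) le_phi le_sum.
set S := [set g in G | _]; rewrite -/a => leGS.
have memS g : (g \in S) = (g \in G) && (#|P : P :^ g| <= a)%N.
  rewrite inE; congr (_ && _); rewrite -{1}(LagrangeI P (P :^ g)) mulnC.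
  by rewrite leq_pmul2r.
have S1: 1 \in S by rewrite memS group1 conjsg1 indexgg.
have sSG: S \subset G by apply/subsetP=> g; rewrite memS => /andP[].
have SV g : g \in S -> g^-1 \in S.
  rewrite !inE groupV => /andP[-> /=]; rewrite -(cardJg (P :&: P :^ g^-1) g).
  by rewrite conjIg conjsgKV setIC.
pose H := <<S>>%G; have sHS := gen_bounded_power sSG S1 SV leGS.
have sHG: H \subset G by rewrite gen_subG.
have sPH: P \subset H.
  apply/subsetP=> x Px; rewrite mem_gen // memS (subsetP sPG) //=.
  by rewrite conjGid // indexgg.
have idxH: (#|G : H| <= a)%N.
  rewrite -(leq_pmul2l (cardG_gt0 H)) Lagrange // (leq_trans leGS) // mulnC leq_mul2r.
  by rewrite subset_leq_card ?orbT ?sub_gen.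
have idxP k h : h \in S ^+ k -> (#|P : P :^ h| <= a ^ k)%N.
  elim: k h => [|k IHk] h; first by rewrite expg0 => /set1P->; rewrite conjsg1 indexgg.
  rewrite expgSr => /mulsgP[u v /IHk le_u Sv ->]; rewrite conjsgM.
  apply: leq_trans (leq_index_trans P (P :^ v) ((P :^ u) :^ v)) _.
  by rewrite /= indexJg expnS leq_mul //; move: Sv; rewrite memS => /andP[].
have leC0: (#|P : 'O_p(H)| <= C0)%N.
  apply: (IH _ _ _ P) => //; rewrite ?indexgg ?(pHall_pgroup sylP) //.
  by move=> h Hh; rewrite idxP // (subsetP sHS).
(* H need not be normal in G. Its core is, and O_p(H) meets the core in a normal p-subgroup of
   it. *)
pose D := gcore H G.
have nDG: D <| G by rewrite gcore_normal.
have sDO: 'O_p(H) :&: D \subset 'O_p(G).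
  apply: subset_trans (_ : 'O_p(D) \subset _).
    apply: pcore_max; first exact: pgroupS (subsetIl _ _) (pcore_pgroup _ _).
    rewrite /normal subsetIr /= normsI ?normG //.
    by rewrite (subset_trans (gcore_sub H G)) // gFnorm.
  by rewrite pcore_max ?pcore_pgroup // gFnormal_trans.
apply: leq_trans (leq_index_subr P sDO) _.
apply: leq_trans (leq_index_setI _ _ _) _; rewrite leq_mul //.
apply: leq_trans (leq_index_subl _ sPG) _.
exact: leq_index_gcore.
Qed.

(** * From commuting probability to centralisers of bounded index *)

(** Integer substitute for a lower bound on Pr(P, Q); one constant serves both as inverse density
    and as index bound. *)
Definition cent_dense (gT : finGroupType) a (P Q : {set gT}) : bool :=
  (#|P| <= a * #|[set x in P | #|Q : 'C[x]| <= a]|)%N.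

Definition commuting_pairs (gT : finGroupType) (P Q : {set gT}) : {set gT * gT} :=
  [set xy in setX P Q | xy.1 * xy.2 == xy.2 * xy.1].

Lemma card_commuting_pairs (gT : finGroupType) (P Q : {set gT}) :
  #|commuting_pairs P Q| =
  (\sum_(x in P) #|Q :&: 'C[x]|)%N.
Proof.
rewrite -sum1dep_card.
under [RHS]eq_bigr => x _ do rewrite -sum1_card.
rewrite pair_big_dep /=; apply: eq_bigl => -[x y] /=.
rewrite in_setX in_setI -andbA; congr (_ && (_ && _)).
by rewrite eq_sym; apply/eqP/cent1P.
Qed.

Lemma card_commuting_pairsC (gT : finGroupType) (P Q : {set gT}) :
  #|commuting_pairs P Q| =
  #|commuting_pairs Q P|.
Proof.
have swapK : involutive (fun u : gT * gT => (u.2, u.1)) by case.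
rewrite -(card_imset _ (inv_inj swapK)); apply: eq_card => -[x y].
apply/imsetP/idP => [[[u v]] | ].
  by rewrite !inE /= => /andP[/andP[Pu Qv] /eqP E] [-> ->]; rewrite Pu Qv E eqxx.
rewrite !inE /= => /andP[/andP[Qx Py] /eqP E].
by exists (y, x); rewrite ?inE //= Qx Py E eqxx.
Qed.

Lemma cent_dense_of_pairs (gT : finGroupType) (P Q : {group gT}) N :
  (#|P| * #|Q| <= N * #|commuting_pairs P Q|)%N ->
  cent_dense (2 * N) P Q.
Proof.
rewrite card_commuting_pairs => le_sum.
have le_phi x : x \in P -> (#|Q :&: 'C[x]| <= #|Q|)%N by rewrite subset_leq_card ?subsetIl.
have := leq_card_popular (cardG_gt0 Q) le_phi le_sum; rewrite /cent_dense.
set X := [set x in P | _]; set Y := [set x in P | _]; suff -> : X = Y by [].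
apply/setP=> x; rewrite !inE; congr (_ && _).
by rewrite -{1}(LagrangeI Q 'C[x]) mulnC leq_pmul2r.
Qed.

Lemma cent_dense_of_commProb (gT : finGroupType) (P Q : {group gT}) (eps : R) :
  (0 < eps)%coqR -> (eps <= commProb P Q)%coqR ->
  let a := (2 * Z.to_nat (up (/ eps)))%N in cent_dense a P Q /\ cent_dense a Q P.
Proof.
move=> eps_gt0 le_eps a.
suff le_pairs: (#|P| * #|Q| <= Z.to_nat (up (/ eps)) *
    #|commuting_pairs P Q|)%N.
  split; apply: cent_dense_of_pairs => //.
  by rewrite mulnC card_commuting_pairsC.
move: le_eps; rewrite /commProb -/(commuting_pairs P Q).
move: #|commuting_pairs P Q| => k.
have: (0 < #|P| * #|Q|)%N by rewrite muln_gt0 !cardG_gt0.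
move: (#|P| * #|Q|)%N => m m_gt0 le_eps.
have [up_gt _] := archimed (/ eps).
have inv_gt0 := Rinv_0_lt_compat _ eps_gt0.
have N_inv : (/ eps <= INR (Z.to_nat (up (/ eps))))%coqR.
  rewrite INR_IZR_INZ Z2Nat.id; first by lra.
  by apply: le_IZR; lra.
move: (Z.to_nat _) N_inv => N N_inv.
have m_gt0' : (0 < INR m)%coqR by apply: lt_0_INR; apply/ltP.
apply/leP; apply: INR_le; rewrite mult_INR.
have : (eps * INR m <= INR k)%coqR.
  have := Rmult_le_compat_r _ _ _ (Rlt_le _ _ m_gt0') le_eps.
  by rewrite /Rdiv Rmult_assoc Rinv_l ?Rmult_1_r //; lra.
move=> le_k; have le1 := Rmult_le_compat_l _ _ _ (Rlt_le _ _ inv_gt0) le_k.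
rewrite -Rmult_assoc Rinv_l ?Rmult_1_l in le1; last by lra.
apply: Rle_trans le1 _; apply: Rmult_le_compat_r => //; exact: pos_INR.
Qed.

(** P1 is generated by the dense set, in 3a + 1 factors, and C(u) :&: C(v) centralises uv. Stating
    the bound through class sizes in G removes Q, so that different q can be combined. *)
Lemma cent_dense_subgroup (gT : finGroupType) (G P Q : {group gT}) (q a : nat) :
  P \subset G -> q.-Sylow(G) Q -> cent_dense a P Q ->
  exists P1 : {group gT}, [/\ P1 \subset P, (#|P : P1| <= a)%N &
    forall x, x \in P1 -> (#|G : 'C_G[x]|`_q <= a ^ (3 * a).+1)%N].
Proof.
rewrite /cent_dense; set X := [set x in P | _] => sPG sylQ leP.
have a_gt0: 0 < a by have := leq_trans (cardG_gt0 P) leP; rewrite muln_gt0 => /andP[].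
have sXP: X \subset P by apply/subsetP=> x; rewrite inE => /andP[].
have idx1: (#|Q : 'C[1]| <= 1)%N.
  by rewrite cent11T leqNgt (indexg_gt1 Q [set: gT]) subsetT.
have X1: 1 \in X by rewrite inE group1 (leq_trans idx1).
have XV x : x \in X -> x^-1 \in X by rewrite !inE groupV -!cent_cycle cycleV.
exists <<X>>%G; split; first by rewrite gen_subG.
  rewrite -(leq_pmul2l (cardG_gt0 <<X>>)) Lagrange ?gen_subG //.
  by rewrite (leq_trans leP) // mulnC leq_mul2r subset_leq_card ?orbT ?sub_gen.
have idx k x : x \in X ^+ k -> (#|Q : 'C[x]| <= a ^ k)%N.
  elim: k x => [|k IHk] x.
    by rewrite expg0 => /set1P->.
  rewrite expgSr => /mulsgP[u v /IHk le_u Xv ->].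
  have sub: 'C[v] :&: 'C[u] \subset 'C[u * v].
    apply/subsetP=> y /setIP[/cent1P cyv /cent1P cyu]; apply/cent1P.
    exact: commuteM.
  apply: leq_trans (leq_index_subr Q sub) _.
  apply: leq_trans (leq_index_setI _ _ _) _; rewrite expnS leq_mul //.
  by move: Xv; rewrite inE => /andP[].
move=> x /(subsetP (gen_bounded_power sXP X1 XV leP)) /idx le_x.
apply: leq_trans (leq_partn_index_Sylow sylQ (subsetIl _ _)) _.
apply: leq_trans le_x; rewrite -indexgI setIA (setIidPl (pHall_sub sylQ)).
by rewrite indexgI.
Qed.

(** * Normality of Sylow subgroups for large primes *)

(** The index |P : C_P(y)| is a power of p; being at most a < p it is 1, so the dense set lies in
    C_Q(P). *)
Lemma cent_dense_pgroup (gT : finGroupType) (P Q : {group gT}) (p a : nat) :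
  p.-group P -> a < p -> cent_dense a Q P -> (#|Q : 'C(P)| <= a)%N.
Proof.
rewrite /cent_dense; set X := [set y in Q | _] => pP lt_ap leQ.
have sX: X \subset Q :&: 'C(P).
  apply/subsetP=> y; rewrite inE => /andP[Qy le_a].
  rewrite in_setI Qy /= -sub_cent1 -indexg_eq1.
  have pi: p.-nat #|P : 'C[y]| by apply: pnat_dvd pP; rewrite dvdn_indexg.
  have [k E] := p_natP pi; move: le_a; rewrite E.
  case: k {E} => // k; rewrite expnS => le_a.
  have: (p <= p * p ^ k)%N by rewrite leq_pmulr // expn_gt0; lia.
  by lia.
rewrite -(leq_pmul2l (cardG_gt0 (Q :&: 'C(P)))) LagrangeI.
by rewrite (leq_trans leQ) // mulnC leq_mul2r subset_leq_card ?orbT.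
Qed.

(** Each q-part of the number of Sylow p-subgroups is at most |Q : N(P)|, hence at most [a]. So this
    number is less than p, and being 1 modulo p it is 1. *)
Lemma Sylow_normal_of_index_cent (gT : finGroupType) (G : {group gT}) p a :
  prime p -> 0 < a -> (a ^ a.+1 < p)%N ->
  (forall q, q \in \pi(G) -> q != p ->
    exists P Q : {group gT},
      [/\ p.-Sylow(G) P, q.-Sylow(G) Q & #|Q : 'C(P)| <= a]%N) ->
  forall P : {group gT}, p.-Sylow(G) P -> P <| G.
Proof.
move=> p_pr a_gt0 lt_p hyp P sylP.
have n_gt0: 0 < #|'Syl_p(G)| by rewrite (card_Syl sylP) indexg_gt0.
have: (#|'Syl_p(G)| <= a ^ a.+1)%N.
  apply: leq_of_partn => // q q_pr.
  have [piGq | npi] := boolP (q \in \pi(G)); last first.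
    rewrite part_p'nat // p'natE //; apply: contra npi => dvq.
    by rewrite mem_primes q_pr cardG_gt0 (dvdn_trans dvq) ?card_Syl_dvd.
  have idx (R Q : {group gT}) : q.-Sylow(G) Q -> p.-Sylow(G) R ->
      (#|'Syl_p(G)|`_q <= #|Q : 'N(R)|)%N.
    move=> sylQ sylR; rewrite (card_Syl sylR).
    apply: leq_trans (leq_partn_index_Sylow sylQ (subsetIl _ _)) _.
    by rewrite -indexgI setIA (setIidPl (pHall_sub sylQ)) indexgI.
  have [Eqp | neq] := eqVneq q p.
    apply: leq_trans (idx P P _ sylP) _; first by rewrite Eqp.
    by apply: leq_trans a_gt0; rewrite leqNgt indexg_gt1 normG.
  have [R [Q [sylR sylQ le_a]]] := hyp q piGq neq.
  apply: leq_trans (idx R Q sylQ sylR) _; apply: leq_trans le_a.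
  exact: leq_index_subr (cent_sub _).
move/leq_ltn_trans/(_ lt_p) => lt_n; have := card_Syl_mod G p_pr.
rewrite modn_small // (card_Syl sylP) => /eqP; rewrite indexg_eq1 subsetI subxx /=.
by rewrite /normal (pHall_sub sylP).
Qed.

(** * Passage to the quotient by the Fitting subgroup *)

Lemma exists_bounded_classes (gT : finGroupType) (G P : {group gT}) (r : seq nat) a e :
  (forall q, q \in r -> exists P1 : {group gT}, [/\ P1 \subset P, (#|P : P1| <= a)%N &
    forall x, x \in P1 -> (#|G : 'C_G[x]|`_q <= e)%N]) ->
  exists P1 : {group gT}, [/\ P1 \subset P, (#|P : P1| <= a ^ size r)%N &
    forall x q, x \in P1 -> q \in r -> (#|G : 'C_G[x]|`_q <= e)%N].
Proof.
elim: r => [|q r IH] hyp; first by exists P; rewrite indexgg.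
have [|P1 [sP1 le1 cl1]] := IH; first by move=> q' rq'; apply: hyp; rewrite inE rq' orbT.
have [P2 [sP2 le2 cl2]] := hyp q (mem_head _ _).
exists (P2 :&: P1)%G; split; first by rewrite subIset ?sP2.
  by rewrite (leq_trans (leq_index_setI _ _ _)) // expnS leq_mul.
move=> x q' /setIP[P2x P1x]; rewrite inE => /predU1P[-> | rq']; first exact: cl2.
exact: cl1.
Qed.

Lemma dvdn_quotient_class_index (gT : finGroupType) (G K : {group gT}) x :
  K <| G -> x \in G -> #|G / K : 'C_(G / K)[coset K x]| %| #|G : 'C_G[x]|.
Proof.
move=> nsKG Gx; have nKG := normal_norm nsKG.
have sub: 'C_G[x] / K \subset 'C_(G / K)[coset K x].
  apply/subsetP=> _ /morphimP[y Ny /setIP[Gy /cent1P cyx] ->].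
  rewrite inE mem_quotient //=; apply/cent1P.
  by rewrite /commute -!morphM ?(subsetP nKG) // cyx.
apply: dvdn_trans (indexgS _ sub) _; apply: index_quotient.
by rewrite subIset ?nKG.
Qed.

Lemma index_Fitting2_bounded a :
  {C : nat | forall (gT : finGroupType) (G : {group gT}), 0 < a ->
    (forall p q, p \in \pi(G) -> q \in \pi(G) -> p != q ->
       exists P Q : {group gT},
         [/\ p.-Sylow(G) P, q.-Sylow(G) Q, cent_dense a P Q & cent_dense a Q P]) ->
    (#|G : Fitting2 G| <= C)%N}.
Proof.
(* [B] will bound the primes dividing |G / F|, its two summands serving the two lemmas on large
   primes; [e] bounds each q-part of a class size. *)
pose B := (a ^ a.+1 + a)%N; pose e := (a ^ (3 * a).+1)%N.
(* At most B + 1 subgroups of index at most [a] get intersected; [leq_of_partn] turns the bound [e]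
   on q-parts into one on the p'-part. *)
have [C1 hC1] := index_pcore_of_class_sizes (a ^ B.+1) (e ^ e.+1).
(* The successor of [C1] also covers the primes not dividing |G / F|, where the part is 1. *)
exists (C1.+1 ^ C1.+2)%N => gT G a_gt0 hyp.
have e_gt0: 0 < e by rewrite expn_gt0 a_gt0.
pose F := 'F(G)%G; have nsFG: F <| G := Fitting_normal G.
have -> : #|G : Fitting2 G| = #|G / F : 'F(G / F)|.
  by rewrite -{1}(quotientGK nsFG) index_cosetpre.
apply: leq_of_partn => // p p_pr.
have piQ q : q \in \pi(G / F) -> q \in \pi(G).
  apply: pi_of_dvd; rewrite ?cardG_gt0 ?dvdn_quotient //.
have partnQ1 n q : prime q -> q \notin \pi(G / F) -> n %| #|G / F|%g -> (n`_q)%N = 1%N.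
  move=> q_pr npi dvn; rewrite part_p'nat // p'natE //; apply: contra npi => dvq.
  by rewrite mem_primes q_pr cardG_gt0 (dvdn_trans dvq).
have [pi_p | npi] := boolP (p \in \pi(G / F)); last first.
  by rewrite partnQ1 ?dvdn_indexg.
have [P sylP] := Sylow_exists p G.
have sylPF: p.-Sylow(G / F) (P / F).
  by rewrite quotient_pHall // (subset_trans (pHall_sub sylP)) ?normal_norm.
have le_pB q : q \in \pi(G / F) -> (q <= B)%N.
  move=> pi_q; have q_pr: prime q by move: pi_q; rewrite mem_primes => /andP[].
  have [S sylS] := Sylow_exists q G.
  rewrite leqNgt; apply/negP=> ltBq.
  have nsSG: S <| G.
    apply: (@Sylow_normal_of_index_cent _ _ q a) => //; first by rewrite /B in ltBq; lia.
    move=> q' pi_q' neq; have [Q0 [P0 [sylQ sylP0 dQP _]]] := hyp _ _ pi_q' (piQ _ pi_q) neq.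
    exists P0, Q0; split=> //.
    apply: (cent_dense_pgroup (pHall_pgroup sylP0)) dQP.
    by rewrite /B in ltBq; lia.
  have sSF: S \subset F by rewrite Fitting_max // (pgroup_nil (pHall_pgroup sylS)).
  have sylSF: q.-Sylow(G / F) (S / F).
    by rewrite quotient_pHall // (subset_trans (pHall_sub sylS)) ?normal_norm.
  have := card_Hall sylSF; rewrite /= quotientS1 // cards1.
  move/eqP; rewrite eq_sym; apply/negP.
  by rewrite p_part_eq1 negbK.
(* Class sizes are bounded in G, where the hypothesis applies, and then pass to G / F by
   divisibility. *)
pose r := [seq q <- iota 0 B.+1 | (q \in \pi(G)) && (q != p)].
have [|P1 [sP1P le_c cl]] := @exists_bounded_classes _ G P r a e.
  move=> q; rewrite mem_filter => /andP[/andP[pi_q neq] _].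
  have [|P0 [Q [sylP0 sylQ dPQ _]]] := hyp p q (piQ _ pi_p) pi_q; first by rewrite eq_sym.
  have [P1 [sP1 le1 cl1]] := cent_dense_subgroup (pHall_sub sylP0) sylQ dPQ.
  (* The Sylow p-subgroup supplied by the hypothesis varies with q; conjugation to the fixed P
     preserves class sizes in G. *)
  have [g Gg ->] := Sylow_trans sylP0 sylP.
  exists (P1 :^ g)%G; split; first by rewrite conjSg.
    by rewrite /= indexJg.
  move=> _ /imsetP[x P1x ->]; apply: leq_trans (cl1 x P1x).
  by rewrite !index_cent1 classGidl.
apply: leq_trans (leq_partn_index_Sylow sylPF (Fitting_sub _)) _.
have sOF: 'O_p(G / F) \subset 'F(G / F).
  by rewrite Fitting_max ?pcore_normal // (pgroup_nil (pcore_pgroup _ _)).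
apply: leq_trans (leq_index_subr _ sOF) _; apply: leqW.
have nFP := subset_trans (pHall_sub sylP) (normal_norm nsFG).
apply: (hC1 _ _ _ (P1 / F)%G) => //; first exact: quotientS.
  apply: leq_trans (dvdn_leq _ (index_quotient _)) _; rewrite ?indexg_gt0 //.
    by rewrite subIset ?nFP.
  apply: leq_trans le_c _; rewrite leq_pexp2l //.
  by rewrite size_filter (leq_trans (count_size _ _)) ?size_iota.
move=> _ /morphimP[x Nx P1x ->].
have Gx: x \in G by rewrite (subsetP (pHall_sub sylP)) ?(subsetP sP1P).
have dvx := dvdn_quotient_class_index nsFG Gx.
apply: leq_of_partn => // q q_pr.
have dvq: #|G / F : 'C_(G / F)[coset F x]|`_p^'`_q %| #|G : 'C_G[x]|`_q.
  by rewrite partn_dvd ?indexg_gt0 // (dvdn_trans (dvdn_part _ _)).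
have [pi_q | npi] := boolP (q \in \pi(G / F)); last first.
  by rewrite partnQ1 // (dvdn_trans (dvdn_part _ _)) ?dvdn_indexg.
have [-> | neq] := eqVneq q p.
  by rewrite part_p'nat // part_pnat.
apply: leq_trans (dvdn_leq _ dvq) _; rewrite ?part_gt0 // cl //.
by rewrite mem_filter neq piQ // mem_iota /= add0n ltnS le_pB.
Qed.

Theorem theorem1p1 :
  exists f : R -> nat,
    forall (gT : finGroupType) (G : {group gT}) (eps : R),
      Rlt 0 eps ->
      (forall p q : nat, p \in \pi(G) -> q \in \pi(G) -> p != q ->
         exists (P Q : {group gT}),
           [/\ P \in 'Syl_p(G)%g, Q \in 'Syl_q(G)%g & Rle eps (commProb P Q)]) ->
      (#|G : Fitting2 G|%g <= f eps)%N.
Proof.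
exists (fun eps => sval (index_Fitting2_bounded (2 * Z.to_nat (up (/ eps))))).
move=> gT G eps eps_gt0 hyp; case: (index_Fitting2_bounded _) => C /= -> //.
  have [up_gt _] := archimed (/ eps); have := Rinv_0_lt_compat _ eps_gt0 => inv_gt0.
  have /lt_IZR: (0 < IZR (up (/ eps)))%coqR by lra.
  by lia.
move=> p q pi_p pi_q neq; have [P [Q []]] := hyp p q pi_p pi_q neq.
rewrite !inE => sylP sylQ /(cent_dense_of_commProb eps_gt0)[dPQ dQP].
by exists P, Q.
Qed.
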